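(* Let $g\ge 2$ be an integer. Let $f$ be a nonnegative trigonometric polynomial, not identically zero, and let $p$ be a trigonometric polynomial such that (i) for every zero $x_0\in[0,2\pi)$ of $f$ and every $j\in\{1,\dots,g-1\}$, $$\lim_{x\to x_0}\frac{\left|p\left(x+\frac{2\pi j}{g}\right)\right|^2}{f(x)}<\infty ;$$ (ii) for every $x\in[0,2\pi)$, $$\sum_{j=0}^{g-1}\left|p\left(x+\frac{2\pi j}{g}\right)\right|^2>0 .$$ For every positive integer $n$ divisible by $g$, put $k=n/g$, $A_n:=C_n(f)$, let $D_n$ be the main diagonal of $A_n$ (as a diagonal matrix), and let $p_{n,g}^k:=C_n(p)\,Z_{n,g}^k\in\mathbb{C}^{n\times k}$. Then there exists a constant $\gamma>0$, independent of $n$, such that for every positive integer $n$ divisible by $g$, $$\min_{y\in\mathbb{C}^k}\left\|x_n-p_{n,g}^k\,y\right\|_{D_n}^2\le \gamma\,\|x_n\|_{A_n}^2\qquad\text{for all }x_n\in\mathbb{C}^n .$$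
   Context: A trigonometric polynomial is a function $h(u)=\sum_{|j|\le c}a_j e^{iju}$ with complex coefficients $a_j$, where $i^2=-1$; it is regarded as a $2\pi$-periodic function on $\mathbb{R}$. The circulant matrix of size $n$ generated by $h$ is $C_n(h)=\sum_{|j|\le c}a_jZ_n^j$, where $Z_n$ is the $n\times n$ cyclic permutation matrix with entries $(Z_n)_{r,s}=1$ if $r-s\equiv 1\ (\mathrm{mod}\ n)$ and $0$ otherwise ($r,s=0,\dots,n-1$). Equivalently, $C_n(h)=F_n\,\mathrm{diag}_{j=0,\dots,n-1}\left(h(2\pi j/n)\right)F_n^H$ with $F_n=\frac1{\sqrt n}\left[e^{-2\pi i jk/n}\right]_{j,k=0}^{n-1}$. For $k=n/g\in\mathbb{N}$, $Z_{n,g}^k\in\mathbb{R}^{n\times k}$ is the matrix with entries $(Z_{n,g}^k)_{r,s}=1$ if $r-gs\equiv 0\ (\mathrm{mod}\ n)$ and $0$ otherwise ($r=0,\dots,n-1$, $s=0,\dots,k-1$). For a Hermitian nonnegative definite matrix $X$, $\|v\|_X^2=\|X^{1/2}v\|_2^2=v^HXv$. *)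

(* Defs.v *)
From mathcomp Require Export all_boot all_order all_algebra.
From mathcomp Require Export spectral.
From mathcomp Require Export complex.
From mathcomp Require Export all_classical all_reals all_analysis.

Export Order.TTheory GRing.Theory Num.Theory.
Export numFieldNormedType.Exports.

#[export] Set Implicit Arguments.
#[export] Unset Strict Implicit.
#[export] Unset Printing Implicit Defensive.

#[global] Open Scope classical_set_scope.
#[global] Open Scope complex_scope.
#[global] Open Scope ring_scope.

(* [tcoef h j] is only meaningful for |j| <= tdeg h: values outside this range
   are ignored by both [teval] and [circulant]. *)
Record trigpoly (R : realType) := TrigPoly {
  tdeg : nat;
  tcoef : int -> R[i] }.

Definition expi (R : realType) (t : R) : R[i] := cos t +i* sin t.

(* The ordinal k < 2c + 1 encodes the frequency j = k - c, with -c <= j <= c. *)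
Definition freq (c : nat) (k : 'I_(c.*2.+1)) : int := k%:Z - c%:Z.

Definition teval (R : realType) (h : trigpoly R) (u : R) : R[i] :=
  \sum_(k < (tdeg h).*2.+1)
     tcoef h (freq k) * expi ((freq k)%:~R * u).

Coercion teval : trigpoly >-> Funclass.

(* The square matrices below have size n.+1, so that they form a unit ring and
   the integer powers Z^j, j possibly negative, are available. *)
Definition cyclic_mx (R : realType) (n : nat) : 'M[R[i]]_n.+1 :=
  \matrix_(r < n.+1, s < n.+1) (r == s + 1 %[mod n.+1])%N%:R.

Definition circulant (R : realType) (n : nat) (h : trigpoly R) :
    'M[R[i]]_n.+1 :=
  \sum_(k < (tdeg h).*2.+1)
     tcoef h (freq k) *: (cyclic_mx R n ^ freq k).

Definition downsampling (R : realType) (n g : nat) :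
    'M[R[i]]_(n.+1, n.+1 %/ g) :=
  \matrix_(r < n.+1, s < n.+1 %/ g) (r == g * s %[mod n.+1])%N%:R.

Definition prolongation (R : realType) (n g : nat) (p : trigpoly R) :
    'M[R[i]]_(n.+1, n.+1 %/ g) :=
  circulant n p *m downsampling R n g.

Definition main_diag (R : realType) (n : nat) (A : 'M[R[i]]_n) : 'M[R[i]]_n :=
  diag_mx (\row_i A i i).

Definition sqnorm (R : realType) (n : nat) (X : 'M[R[i]]_n) (v : 'cV[R[i]]_n) :
    R[i] :=
  ((v ^t* )%sesqui *m X *m v) 0 0.

(* Main.v *)
Require Import Defs.
From mathcomp Require Import ring lra zify.

(** The discrete Fourier transform diagonalises A_n = C_n(f) with eigenvalues
f(t_m), t_m = 2 pi m / n, turns D_n into a scalar d <= max |f|, and turns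
p_{n,g}^k y into m |-> p(t_m) Y(m mod k), with Y an arbitrary vector of length k.
The minimisation thus splits into k independent problems, one for each coset
{l + j k : 0 <= j < g}: approximate (x_j) by a multiple of a = (p(t_l + 2 pi j / g)).
By Lagrange's identity the squared distance is
(1 / (2 |a|^2)) sum_{i,j} |a_i x_j - a_j x_i|^2, hence at most
(2 / |a|^2) sum_j (sum_{i != j} |a_i|^2) |x_j|^2.
Hypothesis (i), the isolation of the zeros of f and compactness give
|a_i|^2 <= c f(t_l + 2 pi j / g) for i != j, and (ii) bounds |a|^2 from below. *)

(** * Discrete Fourier transform and circulant matrices *)

Section Expi.
Variable R : realType.
Implicit Types (t u : R) (h : trigpoly R).

Lemma expiD t u : expi (t + u) = expi t * expi u.
Proof.
by apply/eqP; rewrite eq_complex /= cosD sinD eqxx /= addrC [sin t * _]mulrC.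
Qed.

Lemma expi0 : expi (0 : R) = 1.
Proof. by rewrite /expi cos0 sin0. Qed.

Lemma conj_expi t : Num.conj (expi t) = expi (- t).
Proof. by rewrite /expi cosN sinN. Qed.

Lemma expi_neq0 t : expi t != 0.
Proof.
apply/eqP => et0; have := expiD t (- t).
by rewrite subrr expi0 et0 mul0r => /eqP; rewrite oner_eq0.
Qed.

Lemma expiN t : expi (- t) = (expi t)^-1.
Proof.
by apply: (mulfI (expi_neq0 t)); rewrite -expiD subrr expi0 divff// expi_neq0.
Qed.

Lemma expiXn t n : expi t ^+ n = expi (n%:R * t).
Proof.
elim: n => [|n IHn]; first by rewrite mul0r expi0.
by rewrite exprS IHn -expiD -nat1r mulrDl mul1r.
Qed.

Lemma expiXz t (j : int) : expi t ^ j = expi (j%:~R * t).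
Proof.
case: j => n; first exact: expiXn.
by rewrite NegzE -exprz_inv -expiN -exprnP expiXn mulrNz mulNr mulrN.
Qed.

Lemma expi_2pi n : expi (2 * pi * n%:R : R) = 1.
Proof.
have -> : 2 * pi * n%:R = n%:R * (pi *+ 2) :> R by rewrite mulrC mulr_natl.
by rewrite -expiXn /expi cos2pi sin2pi expr1n.
Qed.

(** The double-angle formula gives $\cos t = 1 - 2\sin^2(t/2)$, and $\sin(t/2) > 0$ on this
    range. *)
Lemma expi_eq1 t : 0 < t < 2 * pi -> expi t != 1.
Proof.
move=> /andP[t0 t2]; apply/eqP => -[ct _].
have s0 : 0 < sin (t / 2) by apply: sin_gt0_pi; lra.
have := cos_mulr2n (t / 2).
have -> : t / 2 *+ 2 = t by rewrite -mulr_natr mulfVK.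
rewrite ct cos2sin2.
by nra.
Qed.

Lemma expi_inj2pi t u : `|t - u| < 2 * pi -> t != u -> expi t != expi u.
Proof.
move=> tu tNu; apply: contraNneq tNu => e.
wlog le_ut : t u tu e / u <= t.
  by move=> W; case: (leP u t) => [/W|/ltW/W]; [|rewrite eq_sym distrC]; apply.
rewrite eq_le le_ut andbT leNgt; apply/negP => lt_ut.
have /negP[] : expi (t - u) != 1.
  by apply: expi_eq1; rewrite subr_gt0 lt_ut -(@ger0_norm _ (t - u)) ?subr_ge0.
by rewrite expiD e -expiD subrr expi0.
Qed.

Lemma teval_periodic h t n : h (t + 2 * pi * n%:R) = h t.
Proof.
rewrite /teval; apply: eq_bigr => k _; congr (_ * _).
by rewrite mulrDr expiD -[expi (_ * (2 * _ * _))]expiXz expi_2pi exp1rz mulr1.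
Qed.

End Expi.

Section Dft.
Variable R : realType.
Local Notation C := R[i].
Implicit Types (h p f : trigpoly R).

Definition gridpt (N a : nat) : R := 2 * pi * a%:R / N%:R.

(** The Fourier matrix without its factor $1/\sqrt N$, so that the normalisation enters only through
    the scalar [N]. Its columns are eigenvectors of the cyclic shift. *)
Definition dft N : 'M[C]_N := \matrix_(r, m) expi (- gridpt N (r * m)).

(** Entry [m] of $F^H v$, with $F$ the matrix [dft N]. The index is a natural number rather than an
    ordinal, so that transforms of fine and coarse vectors can be taken at the same frequency. *)
Definition dtrans N (v : 'cV[C]_N) (m : nat) : C :=
  \sum_(r < N) expi (gridpt N (r * m)) * v r 0.

Lemma gridptD N a b : gridpt N (a + b) = gridpt N a + gridpt N b.
Proof. by rewrite /gridpt natrD mulrDr mulrDl. Qed.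

Lemma gridptM N a b : gridpt N (a * b) = a%:R * gridpt N b.
Proof. by rewrite /gridpt natrM; ring. Qed.

Lemma gridpt_mull N a b : (0 < a)%N -> gridpt (a * N) (a * b) = gridpt N b.
Proof.
move=> a0; have a0' : a%:R != 0 :> R by rewrite pnatr_eq0 -lt0n.
by rewrite /gridpt !natrM [2 * pi * _]mulrCA -mulf_div divff// mul1r.
Qed.

Lemma gridpt_multiple N q : (0 < N)%N -> gridpt N (q * N) = 2 * pi * q%:R.
Proof.
by move=> N0; rewrite /gridpt natrM mulrA mulfK// pnatr_eq0 -lt0n.
Qed.

Lemma expi_gridpt_mod N a b : (0 < N)%N -> a = b %[mod N] ->
  expi (gridpt N a) = expi (gridpt N b).
Proof.
move=> N0 e; rewrite (divn_eq a N) (divn_eq b N) e.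
by rewrite ![gridpt _ (_ + _)]gridptD !gridpt_multiple// !expiD !expi_2pi !mul1r.
Qed.

Lemma gridpt_itv N a : (a < N)%N -> 0 <= gridpt N a < 2 * pi.
Proof.
move=> aN; have N0 : 0 < N%:R :> R by rewrite ltr0n (leq_ltn_trans _ aN).
have pi0 : 0 < 2 * pi :> R by rewrite mulr_gt0// pi_gt0.
rewrite /gridpt divr_ge0 ?mulr_ge0 ?ler0n ?pi_ge0//=.
by rewrite ltr_pdivrMr// ltr_pM2l// ltr_nat.
Qed.

Lemma dft_conj N (v : 'cV[C]_N) m : ((dft N ^t* )%sesqui *m v) m 0 = dtrans v m.
Proof.
rewrite mxE /dtrans; apply: eq_bigr => r _.
by rewrite !mxE conj_expi opprK.
Qed.

(** Off the diagonal the entry is a geometric sum of ratio $z$ with $z^N = 1$ and $z \ne 1$, hence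
    zero. *)
Lemma dft_unitary N : (dft N ^t* )%sesqui *m dft N = N%:R%:M.
Proof.
apply/matrixP => a b; rewrite !mxE.
have [->|ab] := eqVneq a b; last first.
  pose z : C := expi (gridpt N a - gridpt N b).
  have N0 : (0 < N)%N by rewrite (leq_ltn_trans _ (ltn_ord a)).
  have zN : z ^+ N = 1.
    rewrite expiXn mulrBr -!gridptM ![(N * _)%N]mulnC !gridpt_multiple//.
    by rewrite expiD expiN !expi_2pi divff// oner_eq0.
  have z1 : z - 1 != 0.
    rewrite subr_eq0 /z expiD expiN -(inj_eq (mulIf (expi_neq0 (gridpt N b)))).
    rewrite mulfVK ?expi_neq0// mul1r.
    have /andP[? ?] := gridpt_itv (ltn_ord a).
    have /andP[? ?] := gridpt_itv (ltn_ord b).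
    apply: expi_inj2pi; first by rewrite ltr_norml; lra.
    rewrite /gridpt (inj_eq (mulIf _)) ?invr_eq0 ?pnatr_eq0 -?lt0n//.
    by rewrite (inj_eq (mulfI _)) ?eqr_nat// mulf_neq0 ?pnatr_eq0// gt_eqF// pi_gt0.
  transitivity (\sum_(r < N) z ^+ r).
    apply: eq_bigr => r _; rewrite !mxE conj_expi opprK -expiD expiXn.
    by rewrite !gridptM mulrBr.
  by apply: (mulfI z1); rewrite -subrX1 zN subrr mulr0.
rewrite -[N in RHS]card_ord -sumr_const; apply: eq_bigr => r _.
by rewrite !mxE conj_expi opprK -expiD subrr expi0.
Qed.

(** A one-sided inverse of a square matrix is two-sided; size 0, where [N] cannot be inverted, is
    treated apart. *)
Lemma dft_unitaryC N : dft N *m (dft N ^t* )%sesqui = N%:R%:M.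
Proof.
case: N => [|n]; first by apply/matrixP => -[].
have n0 : n.+1%:R != 0 :> C by rewrite pnatr_eq0.
apply: (scalerI (invr_neq0 n0)); rewrite scalemxAr.
rewrite [LHS](@mulmx1C _ _ (n.+1%:R^-1 *: (dft n.+1 ^t* )%sesqui) (dft n.+1)).
  by rewrite scale_scalar_mx mulVf.
by rewrite -scalemxAl dft_unitary scale_scalar_mx mulVf.
Qed.

(** Fourier inversion. It lets a coarse vector be prescribed through its transform, one free value
    per coset. *)
Lemma dtrans_onto N (Y : nat -> C) :
  exists y : 'cV[C]_N, forall l, (l < N)%N -> dtrans y l = Y l.
Proof.
exists (N%:R^-1 *: (dft N *m (\col_l Y l))) => l lN.
rewrite -(dft_conj _ (Ordinal lN)) -scalemxAr mulmxA dft_unitary mul_scalar_mx.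
by rewrite !mxE mulrA mulVf ?mul1r// pnatr_eq0 -lt0n (leq_ltn_trans _ lN).
Qed.

Lemma dtrans_periodic N (v : 'cV[C]_N) m q : dtrans v (m + q * N) = dtrans v m.
Proof.
apply: eq_bigr => r _; congr (_ * _).
have N0 : (0 < N)%N by rewrite (leq_ltn_trans _ (ltn_ord r)).
by apply: expi_gridpt_mod => //; rewrite mulnDr mulnA addnC modnMDl.
Qed.

Lemma dtransB N (u v : 'cV[C]_N) m : dtrans (u - v) m = dtrans u m - dtrans v m.
Proof.
by rewrite /dtrans -sumrB; apply: eq_bigr => r _; rewrite !mxE mulrBr.
Qed.

(** * Circulant matrices in the Fourier basis *)

Lemma col_mulmx m n q (A : 'M[C]_(m, n)) (B : 'M[C]_(n, q)) j :
  col j (A *m B) = A *m col j B.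
Proof. by rewrite !colE mulmxA. Qed.

Lemma eigen_exprz n (A : 'M[C]_n.+1) (w : 'cV[C]_n.+1) (a : C) (j : int) :
  A \in unitmx -> a != 0 -> A *m w = a *: w -> A ^ j *m w = a ^ j *: w.
Proof.
move=> Au a0 Aw.
have Xn k : A ^+ k *m w = a ^+ k *: w.
  elim: k => [|k IHk]; first by rewrite !expr0 mul1mx scale1r.
  by rewrite exprS -mulmxA IHk -scalemxAr Aw scalerA -exprSr.
case: j => k; first exact: Xn.
(* For a negative exponent, multiplying both sides by $a^{k+1}$ reduces the claim to $A^{-(k+1)}
   A^{k+1} w = w$. *)
have Aku : A ^+ k.+1 \is a GRing.unit by rewrite unitrX.
have -> : A ^ Negz k = (A ^+ k.+1)^-1 by [].
have -> : a ^ Negz k = (a ^+ k.+1)^-1 by [].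
have ak0 : a ^+ k.+1 != 0 by rewrite expf_neq0.
apply: (scalerI ak0); rewrite scalerA divff// scale1r scalemxAr -Xn mulmxA.
by rewrite -[A ^- k.+1 *m _]/(A ^- k.+1 * A ^+ k.+1) mulVr// mul1mx.
Qed.

(** Row $r$ of the shift picks the cyclically preceding entry $r - 1$ of the column, whose phase
    differs from that of entry $r$ by $e^{i t_m}$. *)
Lemma cyclic_eigen n m :
  cyclic_mx R n *m col m (dft n.+1) = expi (gridpt n.+1 m) *: col m (dft n.+1).
Proof.
apply/colP => r; rewrite !mxE.
have [s0 es0] : exists s0 : 'I_n.+1, forall s : 'I_n.+1,
    (r == s + 1 %[mod n.+1])%N = (s == s0).
  (* This is $r - 1$ modulo [n.+1], written with [r + n] to avoid truncated subtraction at $r =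
     0$. *)
  exists (inord ((r + n) %% n.+1)) => s; rewrite -val_eqE/= inordK ?ltn_mod//.
  rewrite addn1 modn_small// [in RHS]eq_sym.
  case: r => -[|r] lr /=; rewrite ?add0n.
    rewrite (modn_small (ltnSn n)).
    have := ltn_ord s; rewrite leq_eqVlt => /orP[/eqP e|slt].
      by rewrite e modnn eqxx -eqSS e eqxx.
    by rewrite modn_small//; apply/esym/negbTE; move: slt; rewrite ltnS; lia.
  rewrite addSnnS modnDr (modn_small (ltnW lr)).
  have := ltn_ord s; rewrite leq_eqVlt => /orP[/eqP e|slt].
    by rewrite e modnn/=; apply/esym/negbTE; lia.
  by rewrite modn_small.
rewrite (bigD1 s0)//= big1 ?addr0; last first.
  by move=> s /negbTE ss0; rewrite !mxE es0 ss0 mul0r.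
rewrite !mxE es0 eqxx mul1r.
have /eqP rs : (r == s0 + 1 %[mod n.+1])%N by rewrite es0.
rewrite !expiN -[in LHS](mulfVK (expi_neq0 (gridpt n.+1 m)) (_^-1)) mulrC.
congr (_ * _); rewrite -invfM -expiD -gridptD -[X in (_ + X)%N]mul1n -mulnDl.
by congr _^-1; apply: expi_gridpt_mod => //; rewrite -modnMml -rs modnMml.
Qed.

(** The shift is diagonalised by an invertible matrix with nonzero eigenvalues. Invertibility
    carries the eigenvector relation over to negative powers. *)
Lemma cyclic_unit n : cyclic_mx R n \in unitmx.
Proof.
have n0 : n.+1%:R != 0 :> C by rewrite pnatr_eq0.
have ZW : cyclic_mx R n *m dft n.+1
    = dft n.+1 *m diag_mx (\row_m expi (gridpt n.+1 m)).
  apply/matrixP => r m; have /colP/(_ r) := cyclic_eigen m.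
  rewrite -col_mulmx [LHS]mxE => ->; rewrite mul_mx_diag !mxE.
  by rewrite mulrC.
have Wu : dft n.+1 \in unitmx.
  have : n.+1%:R%:M \in @unitmx C n.+1.
    by rewrite unitmxE det_scalar unitrX// unitfE.
  by rewrite -dft_unitary unitmx_mul => /andP[].
have : cyclic_mx R n *m dft n.+1 \in unitmx.
  rewrite ZW unitmx_mul Wu unitmxE det_diag unitfE/=.
  by apply/prodf_neq0 => m _; rewrite mxE expi_neq0.
by rewrite unitmx_mul => /andP[].
Qed.

Lemma circulant_dft n h : circulant n h *m dft n.+1
  = dft n.+1 *m diag_mx (\row_m h (gridpt n.+1 m)).
Proof.
apply/matrixP => r m; rewrite mul_mx_diag !mxE.
transitivity ((circulant n h *m col m (dft n.+1)) r 0).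
  by rewrite -col_mulmx [RHS]mxE mxE.
rewrite /circulant mulmx_suml summxE /teval mulr_sumr; apply: eq_bigr => k _.
rewrite -scalemxAl (eigen_exprz _ (cyclic_unit n) (expi_neq0 _) (cyclic_eigen m)).
by rewrite !mxE expiXz [RHS]mulrC mulrA.
Qed.

Lemma circulantE n h : circulant n h = n.+1%:R^-1 *:
  (dft n.+1 *m diag_mx (\row_m h (gridpt n.+1 m)) *m (dft n.+1 ^t* )%sesqui).
Proof.
rewrite -circulant_dft -mulmxA dft_unitaryC mul_mx_scalar scalerA mulVf.
  by rewrite scale1r.
by rewrite pnatr_eq0.
Qed.

(** * Norms and prolongation in Fourier variables *)

Lemma sqnorm_dft N (c : C) (d : 'rV[C]_N) (v : 'cV[C]_N) :
  sqnorm (c *: (dft N *m diag_mx d *m (dft N ^t* )%sesqui)) v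
  = c * \sum_(m < N) d 0 m * `|dtrans v m| ^+ 2.
Proof.
rewrite /sqnorm -scalemxAr -scalemxAl mxE; congr (_ * _).
pose V := (dft N ^t* )%sesqui *m v.
have -> : (v ^t* )%sesqui *m (dft N *m diag_mx d *m (dft N ^t* )%sesqui) *m v
    = (V ^t* )%sesqui *m diag_mx d *m V.
  by rewrite /V trmx_mul map_mxM trmxCK !mulmxA.
have : forall m, V m 0 = dtrans v m by exact: dft_conj.
move: V => V VE; rewrite mul_mx_diag mxE; apply: eq_bigr => m _.
by rewrite !mxE VE normCK mulrAC mulrC [_^* * _]mulrC.
Qed.

Lemma sqnorm_circulant n f (v : 'cV[C]_n.+1) : sqnorm (circulant n f) v
  = n.+1%:R^-1 * \sum_(m < n.+1) f (gridpt n.+1 m) * `|dtrans v m| ^+ 2.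
Proof.
by rewrite circulantE sqnorm_dft; under eq_bigr do rewrite mxE.
Qed.

(** On the diagonal the phases of $F$ and $F^H$ cancel, which leaves the mean of [f] over the grid
    in every row. *)
Lemma main_diag_circulant n f : main_diag (circulant n f)
  = (n.+1%:R^-1 * \sum_(m < n.+1) f (gridpt n.+1 m))%:M.
Proof.
rewrite -diag_const_mx; congr diag_mx; apply/rowP => r; rewrite !mxE.
rewrite circulantE !mxE; congr (_ * _).
rewrite mul_mx_diag; apply: eq_bigr => m _; rewrite !mxE conj_expi opprK.
by rewrite mulrAC -expiD addNr expi0 mul1r.
Qed.

Lemma sqnorm_scalar n (a : C) (v : 'cV[C]_n.+1) : sqnorm a%:M v
  = a / n.+1%:R * \sum_(m < n.+1) `|dtrans v m| ^+ 2.
Proof.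
have n0 : n.+1%:R != 0 :> C by rewrite pnatr_eq0.
have -> : a%:M = (a / n.+1%:R) *:
    (dft n.+1 *m diag_mx (const_mx 1) *m (dft n.+1 ^t* )%sesqui).
  by rewrite diag_const_mx mulmx1 dft_unitaryC scale_scalar_mx mulfVK.
by rewrite sqnorm_dft; under eq_bigr do rewrite mxE mul1r.
Qed.

Lemma dtrans_circulant n p (v : 'cV[C]_n.+1) m : (m < n.+1)%N ->
  dtrans (circulant n p *m v) m = p (gridpt n.+1 m) * dtrans v m.
Proof.
move=> mn; rewrite -!(dft_conj _ (Ordinal mn)) circulantE.
rewrite -scalemxAl -scalemxAr !mulmxA dft_unitary mul_scalar_mx.
rewrite -!mulmxA -scalemxAl scalerA mulVf ?pnatr_eq0// scale1r.
by rewrite mul_diag_mx !mxE.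
Qed.

(** Column [s] has its single nonzero entry in row $gs$, and $gs/(gk) = s/k$: the fine transform
    turns into the coarse one, repeated with period $k$ in [m]. *)
Lemma dtrans_downsampling n g (y : 'cV[C]_(n.+1 %/ g)) m : (g %| n.+1)%N ->
  dtrans (downsampling R n g *m y) m = dtrans y m.
Proof.
move=> gn; have gk : (g * (n.+1 %/ g) = n.+1)%N by rewrite mulnC divnK.
have g0 : (0 < g)%N by rewrite (dvdn_gt0 _ gn).
rewrite /dtrans; under eq_bigr do rewrite mxE mulr_sumr.
rewrite exchange_big/=; apply: eq_bigr => s _.
have gs : (g * s < n.+1)%N by rewrite -[X in (_ < X)%N]gk ltn_pmul2l.
rewrite (bigD1 (Ordinal gs))//= big1 ?addr0 => [|r rgs]; last first.
  move: rgs; rewrite -val_eqE/= mxE !modn_small// => /negbTE->.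
  by rewrite mul0r mulr0.
rewrite mxE eqxx mul1r; congr (expi _ * _).
by rewrite -(gridpt_mull _ (s * m) g0) gk mulnA.
Qed.

Lemma dtrans_prolongation n g p (y : 'cV[C]_(n.+1 %/ g)) m :
  (g %| n.+1)%N -> (m < n.+1)%N ->
  dtrans (prolongation n g p *m y) m = p (gridpt n.+1 m) * dtrans y m.
Proof.
by move=> gn mn; rewrite -mulmxA dtrans_circulant// dtrans_downsampling.
Qed.

End Dft.

(** * Distance to a line *)

Section LeastSquaresLine.
Variables (C : numClosedFieldType) (I : finType).
Implicit Types (a x : I -> C).

(** Coefficient of the orthogonal projection of [x] onto the line spanned by [a]. *)
Definition lsq a x : C := (\sum_i (a i)^* * x i) / \sum_i `|a i| ^+ 2.

(** Pythagoras: the residual at [lsq a x] is orthogonal to [a], so the cross terms vanish. *)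
Lemma line_residual a x (z : C) : \sum_i `|a i| ^+ 2 != 0 ->
  \sum_i `|x i - a i * z| ^+ 2
  = \sum_i `|x i - a i * lsq a x| ^+ 2 + (\sum_i `|a i| ^+ 2) * `|lsq a x - z| ^+ 2.
Proof.
move=> s0; set y := lsq a x.
have orth : \sum_i (x i - a i * y) * (a i)^* = 0.
  under eq_bigr do rewrite mulrBl mulrAC -normCK.
  rewrite sumrB -mulr_suml /y /lsq mulrCA divff// mulr1.
  by apply/eqP; rewrite subr_eq0; apply/eqP/eq_bigr => i _; rewrite mulrC.
have orthC : \sum_i (x i - a i * y)^* * a i = 0.
  transitivity (\sum_i (x i - a i * y) * (a i)^*)^*; last by rewrite orth conjC0.
  rewrite rmorph_sum; apply: eq_bigr => i _ /=.
  by rewrite rmorphM/= conjCK.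
transitivity (\sum_i (`|x i - a i * y| ^+ 2 + `|a i| ^+ 2 * `|y - z| ^+ 2
    + (x i - a i * y) * (a i)^* * (y - z)^* + (x i - a i * y)^* * a i * (y - z))).
  apply: eq_bigr => i _.
  have -> : x i - a i * z = (x i - a i * y) + a i * (y - z) by ring.
  rewrite !normCK; move: (x i - a i * y) (y - z) => u v.
  by rewrite rmorphD rmorphM/=; ring.
by rewrite !big_split/= -!mulr_suml orth orthC !mul0r !addr0.
Qed.

(* Lagrange's identity. *)
Lemma line_distance a x : \sum_i `|a i| ^+ 2 != 0 ->
  (\sum_i `|x i - a i * lsq a x| ^+ 2) * (2 * \sum_i `|a i| ^+ 2)
  = \sum_i \sum_j `|a i * x j - a j * x i| ^+ 2.
Proof.
move=> s0; have := @line_residual a x 0 s0.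
under eq_bigr do rewrite mulr0 subr0.
rewrite subr0 /lsq; set s := \sum_i `|a i| ^+ 2; set b := \sum_i _ * _.
set r := \sum_i `|x i - _| ^+ 2 => e.
have sC : s^* = s by rewrite geC0_conj// sumr_ge0// => i _; rewrite exprn_ge0.
(* Pythagoras at $z = 0$ gives $rs = s\|x\|^2 - |b|^2$. Doubling makes the right-hand side symmetric
   in the two factors, so that it matches the double sum term by term. *)
have -> : r * (2 * s) = s * (\sum_i `|x i| ^+ 2) + (\sum_i `|x i| ^+ 2) * s
    - b * b^* - b^* * b.
  by rewrite e normCK rmorphM/= fmorphV/= sC; field.
rewrite /b rmorph_sum/= !big_distrlr/= -big_split/= -!sumrB.
apply: eq_bigr => i _; rewrite -big_split/= -!sumrB; apply: eq_bigr => j _.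
by rewrite !normCK !(rmorphB, rmorphM)/= !conjCK; ring.
Qed.

(** The diagonal terms of Lagrange's identity vanish, so $|a_j|^2$ never multiplies $|x_j|^2$. Hence
    $F_j$ has to dominate only the other $|a_i|^2$ and may vanish where $a_j$ does not. *)
Lemma line_distance_le a x (F : I -> C) (c : C) : 0 < \sum_i `|a i| ^+ 2 ->
  (forall j, \sum_(i | i != j) `|a i| ^+ 2 <= c * F j) ->
  (\sum_i `|x i - a i * lsq a x| ^+ 2) * (\sum_i `|a i| ^+ 2)
   <= 2 * c * \sum_i F i * `|x i| ^+ 2.
Proof.
move=> s0 aF; rewrite -(ler_pM2l (ltr0Sn C 1)) mulrCA line_distance ?gt_eqF//.
apply: (@le_trans _ _ (\sum_i \sum_(j | j != i)
    2 * (`|a i| ^+ 2 * `|x j| ^+ 2 + `|a j| ^+ 2 * `|x i| ^+ 2))).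
  apply: ler_sum => i _; rewrite (bigD1 i)//= subrr normr0 expr0n/= add0r.
  apply: ler_sum => j _; set u := a i * x j; set v := a j * x i.
  have -> : `|a i| ^+ 2 * `|x j| ^+ 2 = `|u| ^+ 2 by rewrite normrM exprMn.
  have -> : `|a j| ^+ 2 * `|x i| ^+ 2 = `|v| ^+ 2 by rewrite normrM exprMn.
  (* The parallelogram identity bounds $|u-v|^2$ by $2(|u|^2+|v|^2)$. *)
  have -> : 2 * (`|u| ^+ 2 + `|v| ^+ 2) = `|u - v| ^+ 2 + `|u + v| ^+ 2.
    by rewrite !normCK !(rmorphB, rmorphD)/=; ring.
  by rewrite lerDl exprn_ge0.
under eq_bigr do rewrite -mulr_sumr big_split/= -mulr_suml.
rewrite -mulr_sumr big_split/= ler_pM2l ?ltr0Sn//.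
have le2 : \sum_i (\sum_(j | j != i) `|a j| ^+ 2) * `|x i| ^+ 2
    <= c * \sum_i F i * `|x i| ^+ 2.
  by rewrite mulr_sumr; apply: ler_sum => i _; rewrite mulrA ler_wpM2r// exprn_ge0.
(* The two halves of the double sum agree after exchanging $i$ and $j$, so each is bounded by
   [le2]. *)
rewrite -mulrA [2 * _]mulr_natl mulr2n lerD//.
rewrite (exchange_big_dep predT)//=.
congr (_ <= _): le2; apply: eq_bigr => j _; rewrite mulr_suml.
by apply: eq_bigl => i; rewrite eq_sym.
Qed.

Lemma line_distance_min a x z : 0 < \sum_i `|a i| ^+ 2 ->
  \sum_i `|x i - a i * lsq a x| ^+ 2 <= \sum_i `|x i - a i * z| ^+ 2.
Proof.
move=> s0; rewrite (line_residual x z) ?gt_eqF// lerDl.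
by rewrite mulr_ge0 ?exprn_ge0// ltW.
Qed.

End LeastSquaresLine.

(** * Bounds on trigonometric polynomials *)

Section Analysis.
Variable R : realType.
Local Notation C := R[i].
Implicit Types (h p f : trigpoly R) (F G : R -> C).

(** Continuity is taken on real and imaginary parts, so that only limits of real functions have to
    be handled. *)
Definition ccontinuous F :=
  continuous (fun u => complex.Re (F u)) /\ continuous (fun u => complex.Im (F u)).

Lemma ccontinuous_cst (c : C) : ccontinuous (fun=> c).
Proof. by split=> u; exact: cvg_cst. Qed.

Lemma ccontinuousD F G :
  ccontinuous F -> ccontinuous G -> ccontinuous (fun u => F u + G u).
Proof.
move=> [Fr Fi] [Gr Gi]; split=> u.
  rewrite (_ : (fun _ => _) = fun u => complex.Re (F u) + complex.Re (G u)).
    by apply: cvgD; [exact: Fr | exact: Gr].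
  by apply/funext => v; case: (F v) (G v) => [? ?] [].
rewrite (_ : (fun _ => _) = fun u => complex.Im (F u) + complex.Im (G u)).
  by apply: cvgD; [exact: Fi | exact: Gi].
by apply/funext => v; case: (F v) (G v) => [? ?] [].
Qed.

Lemma ccontinuousM F G :
  ccontinuous F -> ccontinuous G -> ccontinuous (fun u => F u * G u).
Proof.
move=> [Fr Fi] [Gr Gi]; split=> u.
  rewrite (_ : (fun _ => _) = fun u => complex.Re (F u) * complex.Re (G u)
      - complex.Im (F u) * complex.Im (G u)).
    by apply: cvgB; apply: cvgM; [exact: Fr | exact: Gr | exact: Fi | exact: Gi].
  by apply/funext => v; case: (F v) (G v) => [? ?] [].
rewrite (_ : (fun _ => _) = fun u => complex.Re (F u) * complex.Im (G u)
    + complex.Im (F u) * complex.Re (G u)).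
  by apply: cvgD; apply: cvgM; [exact: Fr | exact: Gi | exact: Fi | exact: Gr].
by apply/funext => v; case: (F v) (G v) => [? ?] [].
Qed.

Lemma ccontinuous_sum n (E : 'I_n -> R -> C) :
  (forall k, ccontinuous (E k)) -> ccontinuous (fun u => \sum_(k < n) E k u).
Proof.
elim: n E => [|n IHn] E Ec.
  by under eq_fun do rewrite big_ord0; exact: ccontinuous_cst.
under eq_fun do rewrite big_ord_recr.
by apply: ccontinuousD => //; exact: IHn.
Qed.

Lemma ccontinuous_expi (c : R) : ccontinuous (fun u => expi (c * u)).
Proof.
split=> u /=.
  apply: (@continuous_comp _ _ _ ( *%R c) (@cos R)); last exact: continuous_cos.
  exact: mulrl_continuous.
apply: (@continuous_comp _ _ _ ( *%R c) (@sin R)); last exact: continuous_sin.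
exact: mulrl_continuous.
Qed.

Lemma ccontinuous_teval h : ccontinuous h.
Proof.
apply: ccontinuous_sum => k; apply: ccontinuousM; first exact: ccontinuous_cst.
exact: ccontinuous_expi.
Qed.

Lemma ccontinuous_horner_expi (q : {poly C}) : ccontinuous (fun u => q.[expi u]).
Proof.
elim/poly_ind: q => [|q c IHq].
  by under eq_fun do rewrite horner0; exact: ccontinuous_cst.
under eq_fun do rewrite hornerMXaddC.
apply: ccontinuousD; last exact: ccontinuous_cst.
apply: ccontinuousM => //.
rewrite (_ : @expi R = fun u => expi (1 * u)); first exact: ccontinuous_expi.
by apply/funext => u; rewrite mul1r.
Qed.

Lemma continuous_normc2 F : ccontinuous F ->
  continuous (fun u => Normc.normc (F u) ^+ 2).
Proof.
move=> [Fr Fi] u.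
rewrite (_ : (fun _ => _) = fun u => complex.Re (F u) ^+ 2 + complex.Im (F u) ^+ 2).
  by apply: cvgD; apply: cvgM; (exact: Fr || exact: Fi).
apply/funext => v; case: (F v) => a b /=.
by rewrite sqr_sqrtr// addr_ge0 ?sqr_ge0.
Qed.

Lemma normc2_gt0 (z : C) : (0 < Normc.normc z ^+ 2) = (z != 0).
Proof.
rewrite exprn_even_gt0//=; congr (~~ _).
by apply/eqP/eqP => [/Normc.eq0_normc|->]; rewrite ?Normc.normc0.
Qed.

Lemma near_neq0 F x : ccontinuous F -> F x != 0 -> \forall y \near x, F y != 0.
Proof.
move=> /continuous_normc2 Fc; rewrite -normc2_gt0 => Fx0.
have Fgt0 : \forall y \near x, 0 < Normc.normc (F y) ^+ 2.
  exact: cvgr_gt (Fc x) _ Fx0.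
by apply: filterS Fgt0 => y; rewrite normc2_gt0.
Qed.

Lemma near_dnbhs_teval_neq0 f x0 : (exists u, f u != 0) ->
  \forall y \near x0^', f y != 0.
Proof.
move=> [u0 fu0].
pose c := tdeg f.
(* [expi (c u) * f u] is a polynomial in [expi u], so a zero of [f] is isolated. *)
pose P : {poly C} := \poly_(k < c.*2.+1) tcoef f (k%:Z - c%:Z).
have PE u : P.[expi u] = expi (c%:R * u) * f u.
  rewrite horner_poly /teval mulr_sumr; apply: eq_bigr => k _.
  rewrite mulrCA -expiD expiXn -mulrDl /freq rmorphB/=.
  by congr (_ * expi (_ * _)); rewrite addrC subrK.
have P0 : P != 0.
  apply/eqP => P0; have := PE u0; rewrite P0 horner0 => /esym/eqP.
  by rewrite mulf_eq0 (negbTE fu0) (negbTE (expi_neq0 _)).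
(* Split off the full power of $X - e^{i x_0}$. The cofactor stays nonzero near $x_0$ by continuity,
   and $e^{iy} \ne e^{i x_0}$ for $0 < |y - x_0| < 2\pi$. *)
have [m [q]] := multiplicity_XsubC P (expi x0).
rewrite P0/= => q0 Pq.
have qn : \forall y \near x0^', q.[expi y] != 0.
  by apply: nbhs_dnbhs; apply: (near_neq0 (ccontinuous_horner_expi q)).
have pi0 : 0 < 2 * pi :> R by rewrite mulr_gt0// pi_gt0.
have nx0 : \forall y \near x0^', y != x0.
  by apply: filterS (nbhs_dnbhs_neq x0) => y; rewrite eq_sym.
have cl : \forall y \near x0^', `|y - x0| < 2 * pi.
  by apply: nbhs_dnbhs; near=> y; rewrite distrC; near: y; exact: cvgr_dist_lt.
near=> y.
have : P.[expi y] != 0.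
  rewrite Pq hornerM horner_exp hornerXsubC mulf_neq0//; first by near: y.
  rewrite expf_neq0// subr_eq0 expi_inj2pi//; by near: y.
by rewrite PE mulf_eq0 negb_or => /andP[].
Unshelve. all: by end_near. Qed.

(** By monotonicity a local constant may be enlarged, so finitely many neighbourhoods share one.
    Compactness is used in its near-covering form, along the filter of constants tending to
    infinity. *)
Lemma compact_bound (a b : R) (Q : R -> R -> Prop) :
  (forall c c' y, c <= c' -> Q c y -> Q c' y) ->
  (forall x, a <= x <= b -> exists c, \forall y \near x, Q c y) ->
  exists2 c, 0 < c & forall y, a <= y <= b -> Q c y.
Proof.
move=> Qmono Qloc.
have /compact_near_coveringP cover := @segment_compact R a b.
have : \forall c \near +oo, `[a, b] `<=` Q c.
  apply: cover => x; rewrite /= in_itv/= => /Qloc[c Qc].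
  exists ([set y | Q c y], [set c' | c <= c']); last first.
    by move=> [y c'] /= [Qcy cc']; exact: Qmono cc' Qcy.
  by split=> //=; exact: nbhs_pinfty_ge (num_real _).
move=> /pinfty_ex_gt0[c c0 Qc]; by exists c.
Qed.

Lemma teval_bounded h : exists2 M : R, 0 < M & forall u, `|h u| <= M%:C.
Proof.
(* The summand 1 keeps the bound positive when all coefficients vanish. *)
exists (1 + \sum_(k < (tdeg h).*2.+1) Normc.normc (tcoef h (freq k))).
  by rewrite ltr_pwDl// sumr_ge0// => k _; case: (tcoef _ _) => *; exact: sqrtr_ge0.
move=> u; rewrite rmorphD rmorph_sum/= ler_wpDl ?ler01//.
apply: le_trans (ler_norm_sum _ _ _) _; apply: ler_sum => k _.
rewrite normrM -[leRHS]mulr1 ler_wpM2l// [`|expi _|]normc_def/=.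
by rewrite cos2Dsin2 sqrtr1.
Qed.

(** * Uniform bounds over one period *)

Section Bounds.
Variables (g : nat) (f p : trigpoly R).
Hypothesis f_ge0 : forall u : R, 0 <= f u.

(** Around each point the quotient has a finite limit, by hypothesis at a zero of [f] and by
    continuity elsewhere, so it is bounded on a punctured neighbourhood. Zeros being isolated, [f]
    is positive there and the denominator can be cleared; compactness makes the constant uniform. *)
Lemma quotient_bound (s : R) : (exists u : R, f u != 0) ->
  (forall x0 : R, 0 <= x0 -> x0 < 2 * pi -> f x0 = 0 ->
     cvg (Normc.normc (p (x + s)) ^+ 2 / complex.Re (f x) @[x --> x0^'])) ->
  exists2 c : R, 0 < c & forall x, 0 <= x <= 2 * pi ->
    Normc.normc (p (x + s)) ^+ 2 <= c * complex.Re (f x).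
Proof.
move=> f_neq0 cvg_pf.
have Ref_ge0 x : 0 <= complex.Re (f x).
  by have := f_ge0 x; rewrite lecE => /andP[].
have Ref_neq0 x : f x != 0 -> complex.Re (f x) != 0.
  by apply: contra_neq => fx; rewrite (complexE (f x)) fx ger0_Im// mulr0 addr0.
have Fc : continuous (fun x => complex.Re (f x)).
  by have [] := ccontinuous_teval f.
have Pc : continuous (fun x => Normc.normc (p (x + s)) ^+ 2).
  have pc := continuous_normc2 (ccontinuous_teval p) => x.
  apply: (@continuous_comp _ _ _ (fun x => x + s)
    (fun x => Normc.normc (p x) ^+ 2)); last exact: pc.
  by apply: cvgD; [exact: cvg_id | exact: cvg_cst].
have local x : 0 <= x -> x < 2 * pi -> exists c, \forall y \near x,
    Normc.normc (p (y + s)) ^+ 2 <= c * complex.Re (f y).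
  move=> x0 x2.
  have : cvg (Normc.normc (p (y + s)) ^+ 2 / complex.Re (f y) @[y --> x^']).
    have [fx0|fx0] := eqVneq (f x) 0; first exact: cvg_pf.
    apply/cvg_ex; exists (Normc.normc (p (x + s)) ^+ 2 / complex.Re (f x)).
    apply: cvgM; first exact: (cvg_trans (cvg_app _ (@nbhs_dnbhs _ x)) (Pc x)).
    apply: cvgV; first exact: Ref_neq0.
    exact: (cvg_trans (cvg_app _ (@nbhs_dnbhs _ x)) (Fc x)).
  move=> /cvg_ex[l /cvgr_norm_ley/pinfty_ex_gt0[c c0 qc]].
  have qcd : \forall y \near x^',
      Normc.normc (p (y + s)) ^+ 2 <= c * complex.Re (f y).
    near=> y.
    have Fy : 0 < complex.Re (f y).
      rewrite lt_def Ref_ge0 andbT Ref_neq0//; near: y.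
      exact: near_dnbhs_teval_neq0.
    rewrite -ler_pdivrMr//; apply: le_trans (ler_norm _) _; near: y.
    exact: qc.
  exists c.
  (* At the centre [f] may vanish, so the inequality is obtained there by passing to the limit. *)
  have qcx : Normc.normc (p (x + s)) ^+ 2 <= c * complex.Re (f x).
    apply: (@ler_cvg_to _ _ _ _ (fun y => Normc.normc (p (y + s)) ^+ 2)
      (fun y => c * complex.Re (f y)) _ _ _ _ qcd).
      exact: (cvg_trans (cvg_app _ (@nbhs_dnbhs _ x)) (Pc x)).
    apply: cvgM; first exact: cvg_cst.
    exact: (cvg_trans (cvg_app _ (@nbhs_dnbhs _ x)) (Fc x)).
  move: qcd; rewrite near_withinE => qcd; apply: filterS qcd => y yx.
  by have [->//|/yx] := eqVneq y x.
apply: compact_bound => [c c' y cc' /le_trans|x /andP[x0]].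
  by apply; rewrite ler_wpM2r.
(* The endpoint $2\pi$ lies outside the half-open interval of the hypothesis; its local bound is
   that of 0, moved by one period. *)
rewrite le_eqVlt => /predU1P[->|]; last exact: local.
have [|c loc0] := local 0 (lexx 0); first by rewrite mulr_gt0 ?pi_gt0.
exists c.
have shift0 : (y - 2 * pi @[y --> (2 * pi : R)]) --> (0 : R).
  rewrite -[X in _ --> X](subrr (2 * pi)).
  by apply: cvgB; [exact: cvg_id | exact: cvg_cst].
have shifted : \forall y \near (2 * pi : R),
    Normc.normc (p (y - 2 * pi + s)) ^+ 2 <= c * complex.Re (f (y - 2 * pi)).
  exact: shift0 _ loc0.
apply: filterS shifted => y.
rewrite -(teval_periodic f (y - _) 1) -(teval_periodic p (y - _ + s) 1) mulr1.
by rewrite [y - _ + s + _]addrAC !subrK.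
Unshelve. all: by end_near. Qed.

(** A continuous positive function on a compact interval is bounded away from 0. The form $1 \le cS$
    is monotone in $c$, as [compact_bound] requires. *)
Lemma sum_bound :
  (forall x : R, 0 <= x -> x < 2 * pi ->
     0 < \sum_(j < g) Normc.normc (p (x + 2 * pi * j%:R / g%:R)) ^+ 2) ->
  exists2 c : R, 0 < c & forall x, 0 <= x <= 2 * pi ->
    1 <= c * \sum_(j < g) Normc.normc (p (x + 2 * pi * j%:R / g%:R)) ^+ 2.
Proof.
pose S (x : R) := \sum_(j < g) Normc.normc (p (x + 2 * pi * j%:R / g%:R)) ^+ 2.
rewrite -[X in X -> _]/(forall x, 0 <= x -> x < 2 * pi -> 0 < S x) => sum_gt0.
rewrite -[X in _ X]/(fun c => forall x, 0 <= x <= 2 * pi -> 1 <= c * S x).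
have S_ge0 x : 0 <= S x by rewrite sumr_ge0// => j _; exact: sqr_ge0.
have Sc : continuous S.
  apply: continuous_big => [|j _ x]; first exact: add_continuous.
  have pc := continuous_normc2 (ccontinuous_teval p).
  apply: (@continuous_comp _ _ _ (fun x => x + 2 * pi * j%:R / g%:R)
    (fun x => Normc.normc (p x) ^+ 2)); last exact: pc.
  by apply: cvgD; [exact: cvg_id | exact: cvg_cst].
have S2pi : S (2 * pi) = S 0.
  apply: eq_bigr => j _; rewrite -(teval_periodic p (0 + _) 1) mulr1.
  by rewrite add0r addrC.
apply: compact_bound => [c c' y cc' /le_trans|x /andP[x0 x2]].
  by apply; rewrite ler_wpM2r// S_ge0.
have Sx : 0 < S x.
  have [->|x2'] := eqVneq x (2 * pi).
    by rewrite S2pi; apply: sum_gt0; rewrite ?mulr_gt0 ?pi_gt0.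
  by apply: sum_gt0; rewrite // lt_neqAle x2'.
(* By continuity $S(y) > S(x)/2$ for $y$ near $x$. *)
exists (2 / S x).
have Sx2 : S x / 2 < S x by lra.
have Sgt : \forall y \near x, S x / 2 < S y by exact: cvgr_gt (Sc x) _ Sx2.
apply: filterS Sgt => y Sy.
have : 2 / S x * (S x / 2) <= 2 / S x * S y.
  by rewrite ler_wpM2l ?(ltW Sy)// divr_ge0.
by rewrite mulrA divfK ?gt_eqF// divff.
Qed.

End Bounds.

End Analysis.

(** * The approximation property *)

Lemma normc2C (R : realType) (z : R[i]) :
  `|z| ^+ 2 = (Normc.normc z ^+ 2)%:C.
Proof. by rewrite rmorphXn. Qed.

Lemma sum_cosets (V : nmodType) (N g k : nat) (E : nat -> V) : N = (g * k)%N ->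
  \sum_(m < N) E m = \sum_(l < k) \sum_(j < g) E (l + j * k)%N.
Proof.
move=> ->; rewrite -(big_mkord xpredT) big_nat_mul exchange_big/= big_mkord.
apply: eq_bigr => j _.
by rewrite -{1}[(j * k)%N]add0n big_addn mulSn addnK big_mkord.
Qed.

Lemma gridpt_coset (R : realType) (g k l j : nat) : (0 < k)%N ->
  gridpt R (g * k) (l + j * k) = gridpt R (g * k) l + 2 * pi * j%:R / g%:R.
Proof.
by move=> k0; rewrite gridptD ![(_ * k)%N]mulnC [gridpt _ _ (k * j)]gridpt_mull.
Qed.

Section TwoGrid.
Variables (R : realType) (g : nat) (f p : trigpoly R) (c B M : R).
Local Notation C := R[i].
Hypothesis g_ge2 : (2 <= g)%N.
Hypothesis f_ge0 : forall u : R, 0 <= f u.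
Hypothesis c_ge0 : 0 <= c.
Hypothesis B_ge0 : 0 <= B.
Hypothesis shift_le : forall j : nat, (1 <= j <= g.-1)%N ->
  forall x, 0 <= x <= 2 * pi ->
    Normc.normc (p (x + 2 * pi * j%:R / g%:R)) ^+ 2 <= c * complex.Re (f x).
Hypothesis sum_ge : forall x, 0 <= x <= 2 * pi ->
  1 <= B * \sum_(j < g) Normc.normc (p (x + 2 * pi * j%:R / g%:R)) ^+ 2.
Hypothesis f_le : forall u, `|f u| <= M%:C.

(** Two distinct points of a coset differ, modulo $2\pi$, by $2\pi d/g$ with $1 \le d \le g-1$, so
    [shift_le] applies at the point of index [j]. *)
Lemma coset_shift_le k l (i j : 'I_g) : (l < k)%N -> i != j ->
  `|p (gridpt R (g * k) (l + i * k))| ^+ 2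
    <= c%:C * f (gridpt R (g * k) (l + j * k)).
Proof.
move=> lk ij; have k0 : (0 < k)%N by rewrite (leq_ltn_trans _ lk).
have g0 : (0 < g)%N by rewrite (leq_trans _ g_ge2).
set t := gridpt R (g * k) (l + j * k).
have t_itv : 0 <= t <= 2 * pi.
  have lt_gk : (l + j * k < g * k)%N.
    by rewrite (@leq_trans (j.+1 * k))// ?leq_mul2r ?ltn_ord ?orbT// mulSn ltn_add2r.
  by have /andP[-> /ltW] := gridpt_itv R lt_gk.
have -> : f t = (complex.Re (f t))%:C by rewrite RRe_real ?ger0_real.
suff [d d_itv ->] : exists2 d : nat, (1 <= d <= g.-1)%N &
    p (gridpt R (g * k) (l + i * k)) = p (t + 2 * pi * d%:R / g%:R).
  by rewrite normc2C -rmorphM lecR shift_le.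
have ij' : i != j :> nat by [].
have ltig := ltn_ord i; have ltjg := ltn_ord j.
have [le_ji|lt_ij] := leqP j i.
  exists (i - j)%N; first by lia.
  by rewrite /t !gridpt_coset// -[in LHS](subnK le_ji) natrD; congr (teval p _); ring.
(* For $i < j$ the shift wraps around: adding $g$ to $i - j$ costs one full period of [p]. *)
exists (i + g - j)%N; first by lia.
rewrite /t -(teval_periodic p _ 1) !gridpt_coset//; congr (teval p _).
have e : (i + g - j + j = i + g)%N by lia.
have g0' : g%:R != 0 :> R by rewrite pnatr_eq0 -lt0n.
have {e}e : (i + g - j)%:R + j%:R = i%:R + g%:R :> R by rewrite -!natrD e.
have -> : i%:R = (i + g - j)%:R + j%:R - g%:R :> R by rewrite e addrK.
by field.
Qed.

(** This is [line_distance_le] with [f] on the coset as weight. Positivity of $\|a\|^2$ is returned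
    too, since optimality of [lsq] depends on it. *)
Lemma coset_residual_le k l (x : 'I_g -> C) : (l < k)%N ->
  let a (j : 'I_g) := p (gridpt R (g * k) (l + j * k)) in
  \sum_j `|x j - a j * lsq a x| ^+ 2 <=
  (2 * g%:R * c * B)%:C *
    \sum_(j < g) f (gridpt R (g * k) (l + j * k)) * `|x j| ^+ 2
  /\ 0 < \sum_j `|a j| ^+ 2.
Proof.
move=> lk a; have k0 : (0 < k)%N by rewrite (leq_ltn_trans _ lk).
have g0 : (0 < g)%N by rewrite (leq_trans _ g_ge2).
have Bs : 1 <= B%:C * \sum_j `|a j| ^+ 2.
  have l_itv : 0 <= gridpt R (g * k) l <= 2 * pi.
    by have /andP[-> /ltW] := gridpt_itv R (leq_trans lk (leq_pmull k g0)).
  have := sum_ge l_itv; rewrite -lecR rmorphM rmorph_sum/= => /le_trans; apply.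
  rewrite le_eqVlt; apply/orP/or_introl/eqP; congr (_ * _); apply: eq_bigr => j _.
  by rewrite normc2C /a gridpt_coset.
have s_gt0 : 0 < \sum_j `|a j| ^+ 2.
  rewrite lt_def sumr_ge0 ?andbT => [|j _]; last by rewrite exprn_ge0.
  by apply: contraTneq Bs => ->; rewrite mulr0 lt_geF.
split=> //; set r := \sum_j _.
have r_ge0 : 0 <= r by rewrite sumr_ge0// => j _; rewrite exprn_ge0.
pose F (j : 'I_g) := f (gridpt R (g * k) (l + j * k)).
(* Each term with $i \ne j$ is at most $cF_j$, and the missing term $i = j$ is counted as $0 \le
   cF_j$, whence the factor $g$. *)
have rs : r * (\sum_j `|a j| ^+ 2)
    <= 2 * (g%:R * c)%:C * \sum_j F j * `|x j| ^+ 2.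
  apply: line_distance_le => // j.
  rewrite rmorphM/= rmorph_nat -mulrA mulr_natl.
  rewrite -[in leRHS](card_ord g) -sumr_const big_mkcond; apply: ler_sum => i _.
  case: ifPn => ij; first exact: coset_shift_le.
  by rewrite mulr_ge0 ?ler0c ?f_ge0.
(* The lower bound $1 \le B\|a\|^2$ absorbs the factor $\|a\|^2$ on the left. *)
apply: (@le_trans _ _ (r * (B%:C * \sum_j `|a j| ^+ 2))).
  by rewrite -[leLHS]mulr1 ler_wpM2l.
have -> : (2 * g%:R * c * B)%:C = B%:C * (2 * (g%:R * c)%:C) :> C.
  by rewrite !rmorphM/= !rmorph_nat; ring.
by rewrite mulrCA -[leRHS]mulrA ler_wpM2l ?ler0c.
Qed.

Lemma approximation_property n (x : 'cV[C]_n.+1) : (g %| n.+1)%N ->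
  let A := circulant n f in let D := main_diag A in let P := prolongation n g p in
  exists2 y : 'cV[C]_(n.+1 %/ g),
    (forall z : 'cV[C]_(n.+1 %/ g),
       sqnorm D (x - P *m y) <= sqnorm D (x - P *m z)) &
    sqnorm D (x - P *m y) <= (M * (2 * g%:R * c * B))%:C * sqnorm A x.
Proof.
move=> gn A D P; set k := (n.+1 %/ g)%N.
have Nk : n.+1 = (g * k)%N by rewrite mulnC divnK.
pose a l (j : 'I_g) := p (gridpt R n.+1 (l + j * k)).
pose X l (j : 'I_g) := dtrans x (l + j * k).
(* The minimiser: its transform at [l] is the least-squares coefficient of coset [l]. *)
have [y yE] := dtrans_onto k (fun l => lsq (a l) (X l)).
have N0 : 0 <= n.+1%:R^-1 :> C by rewrite invr_ge0 ler0n.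
pose d : C := n.+1%:R^-1 * \sum_(m < n.+1) f (gridpt R n.+1 m).
have d_ge0 : 0 <= d by rewrite mulr_ge0// sumr_ge0.
have d_le : d <= M%:C.
  have -> : M%:C = n.+1%:R^-1 * \sum_(m < n.+1) M%:C.
    by rewrite sumr_const card_ord -[M%:C *+ _]mulr_natl mulKf ?pnatr_eq0.
  rewrite ler_wpM2l// ler_sum// => m _.
  by rewrite -[f _]ger0_norm.
(* The transform of [z] has period $k$, so on coset [l] the subtracted vector is [a l] times the
   single number [dtrans z l]. *)
have normE z : sqnorm D (x - P *m z) = d / n.+1%:R *
    \sum_(l < k) \sum_(j < g) `|X l j - a l j * dtrans z l| ^+ 2.
  rewrite /D /A main_diag_circulant sqnorm_scalar; congr (_ * _).
  transitivity (\sum_(m < n.+1) `|dtrans x m - p (gridpt R n.+1 m) * dtrans z m| ^+ 2).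
    by apply: eq_bigr => m _; rewrite dtransB dtrans_prolongation.
  rewrite (@sum_cosets _ _ g k (fun m => `|dtrans x m - p (gridpt R n.+1 m) *
    dtrans z m| ^+ 2) Nk).
  by do 2!apply: eq_bigr => ? _; rewrite dtrans_periodic.
have coset (l : 'I_k) := coset_residual_le (X l) (ltn_ord l).
rewrite -Nk in coset.
exists y => [z|].
  rewrite !normE ler_wpM2l ?(mulr_ge0 d_ge0 N0)//; apply: ler_sum => l _.
  by rewrite yE//; apply: line_distance_min; exact: (coset l).2.
rewrite normE /A sqnorm_circulant.
rewrite (@sum_cosets _ _ g k (fun m => f (gridpt R n.+1 m) * `|dtrans x m| ^+ 2) Nk).
(* The diagonal value $d$ is bounded by [M]; the estimates on the cosets remain to be summed. *)
rewrite [_%:C]rmorphM/= -mulrA -[leRHS]mulrA ler_pM// ?mulr_ge0//.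
  by do 2!apply: sumr_ge0 => ? _; rewrite exprn_ge0.
rewrite mulrCA ler_wpM2l// mulr_sumr; apply: ler_sum => l _.
by rewrite yE//; exact: (coset l).1.
Qed.

End TwoGrid.


Theorem theorem5p1 (R : realType) (g : nat) (f p : trigpoly R)
  (g_ge2 : (2 <= g)%N)
  (f_ge0 : forall u : R, 0 <= f u)
  (f_neq0 : exists u : R, f u != 0)
  (lim_fin : forall x0 : R, 0 <= x0 -> x0 < 2 * pi -> f x0 = 0 ->
     forall j : nat, (1 <= j <= g.-1)%N ->
       cvg (Normc.normc (p (x + 2 * pi * j%:R / g%:R)) ^+ 2 / complex.Re (f x)
              @[x --> x0^']))
  (sum_gt0 : forall x : R, 0 <= x -> x < 2 * pi ->
     0 < \sum_(j < g) Normc.normc (p (x + 2 * pi * j%:R / g%:R)) ^+ 2) :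
  exists2 gamma : R, 0 < gamma &
    forall n : nat, (g %| n.+1)%N ->
    let A := circulant n f in
    let D := main_diag A in
    let P := prolongation n g p in
    forall x : 'cV[R[i]]_n.+1,
    exists2 y : 'cV[R[i]]_(n.+1 %/ g),
      (forall z : 'cV[R[i]]_(n.+1 %/ g),
         sqnorm D (x - P *m y) <= sqnorm D (x - P *m z)) &
      sqnorm D (x - P *m y) <= gamma%:C * sqnorm A x.
Proof.
have [M M0 fM] := teval_bounded f.
(* One constant for each shift $1 \le j \le g-1$, with default value 1 for other [j]; positivity
   everywhere makes their sum dominate each of them. *)
have /choice[c cP] (j : nat) : exists c : R, 0 < c /\ ((1 <= j <= g.-1)%N ->
    forall x, 0 <= x <= 2 * pi ->
    Normc.normc (p (x + 2 * pi * j%:R / g%:R)) ^+ 2 <= c * complex.Re (f x)).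
  have [j_itv|] := boolP (1 <= j <= g.-1)%N; last by exists 1.
  have [c c0 cP] := quotient_bound f_ge0 f_neq0
    (fun x0 x00 x02 fx0 => lim_fin x0 x00 x02 fx0 j j_itv).
  by exists c.
have [B B0 BP] := sum_bound sum_gt0.
have g0 : (0 < g)%N by rewrite (leq_trans _ g_ge2).
pose c' := \sum_(j < g) c j.
have c_le (j : 'I_g) : c j <= c'.
  by rewrite /c' (bigD1 j)//= lerDl sumr_ge0// => i _; case: (cP i) => /ltW.
have c'0 : 0 < c' by apply: lt_le_trans (c_le (Ordinal g0)); case: (cP 0).
(* [M] bounds the diagonal, 2 is the parallelogram factor, [g * c'] bounds the sum over $i \ne j$,
   and [B] comes from the lower bound on $\|a\|^2$. *)
exists (M * (2 * g%:R * c' * B)); first by rewrite !mulr_gt0// ltr0n.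
move=> n gn A D P x; apply: approximation_property => //; try exact: ltW.
move=> j j_itv {}x x_itv; have [_ /(_ j_itv x x_itv)] := cP j.
have jg : (j < g)%N by lia.
move=> /le_trans; apply; rewrite ler_wpM2r ?(c_le (Ordinal jg))//.
by have := f_ge0 x; rewrite lecE => /andP[].
Qed.
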